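(* Let $A\in\mathbb{R}^{n\times n}$ and let $B\in\mathbb{R}^{n\times m}$ have full column rank. Let $\lambda_1,\dots,\lambda_\nu$ be distinct complex numbers forming a self-conjugate set $\mathcal L=\{\lambda_1,\dots,\lambda_\nu\}$, with positive integer multiplicities $\mathcal M=\{m_1,\dots,m_\nu\}$, $m_1+\dots+m_\nu=n$, where complex conjugate elements have equal multiplicities. Assume that any uncontrollable modes of $(A,B)$ are included in $\mathcal L$, and that $(A,B,\mathcal L,\mathcal M)$ is such that at least one real $m\times n$ matrix $F$ solves the exact pole placement equation (defined in the context). Let the eigenvalues be ordered so that, for some integer $s\ge 0$, $\lambda_1,\dots,\lambda_{2s}$ are complex (non-real), $\lambda_{2s+1},\dots,\lambda_\nu$ are real, and $\lambda_{i+1}=\bar\lambda_i$ for all odd $i\le 2s$. For each $i$ let $T_i$ be a basis matrix for the nullspace of $S(\lambda_i)=[A-\lambda_i I_n\ \ B]$, let $s_i$ be the dimension of this nullspace, and let $T=[T_1\ \cdots\ T_\nu]$, where $T_{i+1}=\bar T_i$ for odd $i\le 2s$ and $T_i$ is real for $i>2s$. Let the parameter matrix be the block diagonal matrix $K=\operatorname{diag}(K_1,\dots,K_\nu)$, where each $K_i$ has dimension $s_i\times m_i$, $K_i=\bar K_{i+1}$ for all odd $i\le 2s$, and $K_i$ is real for $i>2s$. Let $M(K)=TK$, an $(n+m)\times n$ complex matrix, and let $$X(K)=\overline{\pi}(M(K)),\qquad V(K)=\overline{\pi}(\mathrm{Re}(M(K))),\qquad W(K)=\underline{\pi}(\mathrm{Re}(M(K))).$$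 Then: 1. For almost every choice of the parameter matrix $K$, the rank of $X(K)$ is equal to $n$. 2. The set of all real $m\times n$ gain matrices $F$ that solve the exact pole placement equation is parameterised in $K$ as $$F(K)=W(K)V(K)^{-1},$$ where $K$ ranges over the parameter matrices such that $\operatorname{rank}(X(K))=n$. That is, the set of solutions $F$ is exactly the set of all such $F(K)$.
   Context: Exact pole placement equation: a real $m\times n$ matrix $F$ solves it if there is a non-singular $n\times n$ matrix $X$, whose columns are closed-loop eigenvectors of unit length, such that $$(A+BF)X=X\Lambda,$$ where $\Lambda$ is the $n\times n$ diagonal matrix $\Lambda=\operatorname{diag}(\lambda_1 I_{m_1},\dots,\lambda_\nu I_{m_\nu})$ obtained from the eigenvalues in $\mathcal L$ including multiplicities. A basis matrix for a subspace is a matrix whose columns form a basis of that subspace. Here nullspaces are taken over $\mathbb{C}$, and $S(\lambda_i)$ is $n\times(n+m)$, so $T_i$ is $(n+m)\times s_i$. A bar over a matrix denotes entrywise complex conjugation. For a matrix $Y$ with $n+m$ rows, $\overline{\pi}(Y)$ is the matrix formed by its first $n$ rows and $\underline{\pi}(Y)$ is the matrix formed by its last $m$ rows. Partition $M(K)=[M_1\,|\,\cdots\,|\,M_\nu]$ with $M_i=T_iK_i$ of dimension $(n+m)\times m_i$. The notation $\mathrm{Re}(M(K))$ does not denote the entrywise real part. It denotes the real matrix of the same dimension as $M(K)$ obtained as follows: for each odd $i\le 2s$, the consecutive complex conjugate blocks $M_i, M_{i+1}$ are replaced by $\frac12(M_i+M_{i+1})$ and $\frac1{2j}(M_i-M_{i+1})$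 respectively, where $j=\sqrt{-1}$. The blocks $M_i$ with $i>2s$ are left unchanged. ''Almost every choice of $K$'' is meant with respect to Lebesgue measure on the real vector space of admissible parameter matrices $K$ (those block diagonal matrices with $K_i=\bar K_{i+1}$ for odd $i\le 2s$ and $K_i$ real for $i>2s$). *)

(* Defs.v *)
From HB Require Import structures.
From mathcomp Require Import all_boot all_order all_algebra.
From mathcomp Require Import all_classical all_reals all_analysis.
From mathcomp Require Import complex.

Set Implicit Arguments.
Unset Strict Implicit.
Unset Printing Implicit Defensive.

Import Order.TTheory GRing.Theory Num.Theory.

Local Open Scope classical_set_scope.
Local Open Scope ring_scope.

Definition cplx_mx (R : realType) (p q : nat) (M : 'M[R]_(p, q)) :
    'M[R[i]]_(p, q) :=
  map_mx (real_complex R) M.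

Definition conj_mx (R : realType) (p q : nat) (M : 'M[R[i]]_(p, q)) :
    'M[R[i]]_(p, q) :=
  map_mx (@conjc R) M.

(* M' is the conjugate of M; the sizes of M and M', which are only
   propositionally equal for the blocks considered below, must agree. *)
Definition conjugate_mx (R : realType) (p q p' q' : nat)
    (M : 'M[R[i]]_(p, q)) (M' : 'M[R[i]]_(p', q')) : Prop :=
  exists e : (p = p') * (q = q'), M' = castmx e (conj_mx M).

(* Indices are 0-based: the consecutive pairs {i, i+1} with i odd and i <= 2s
   become {i, j} with i even, i < 2s and j = i + 1. *)
Definition conj_pair (nu s : nat) (i j : 'I_nu) : Prop :=
  [&& ~~ odd i, (i < s.*2)%N & j == i.+1 :> nat].

Definition S_mx (R : realType) (n m : nat) (A : 'M[R]_n) (B : 'M[R]_(n, m))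
    (z : R[i]) : 'M[R[i]]_(n, n + m) :=
  row_mx (cplx_mx A - z%:M) (cplx_mx B).

(* The row space of kermx S^T is the transpose of {v | S v = 0}. *)
Definition nullity (F : fieldType) (p q : nat) (S : 'M[F]_(p, q)) : nat :=
  \rank (kermx S^T).

Definition nullspace_basis (F : fieldType) (p q d : nat)
    (S : 'M[F]_(p, q)) (T : 'M[F]_(q, d)) : Prop :=
  row_free T^T /\ (T^T :=: kermx S^T)%MS.

Definition uncontrollable_mode (R : realType) (n m : nat)
    (A : 'M[R]_n) (B : 'M[R]_(n, m)) (z : R[i]) : Prop :=
  eigenvalue (cplx_mx A) z /\ (\rank (S_mx A B z) < n)%N.

Definition Lambda_mx (R : realType) (nu : nat) (lam : 'I_nu -> R[i])
    (mu : 'I_nu -> nat) : 'M[R[i]]_(\sum_i mu i) :=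
  \mxdiag_(i < nu) ((lam i)%:M : 'M[R[i]]_(mu i)).

Definition solves_EPP (R : realType) (n m nu : nat)
    (A : 'M[R]_n) (B : 'M[R]_(n, m)) (lam : 'I_nu -> R[i]) (mu : 'I_nu -> nat)
    (hn : (\sum_i mu i)%N = n) (F : 'M[R]_(m, n)) : Prop :=
  exists X : 'M[R[i]]_n,
    [/\ X \in unitmx,
        forall k : 'I_n, \sum_(r < n) `|X r k| ^+ 2 = 1
      & cplx_mx (A + B *m F) *m X = X *m castmx (hn, hn) (Lambda_mx lam mu)].

Definition admissible (R : realType) (nu s : nat) (d mu : 'I_nu -> nat)
    (K : forall i : 'I_nu, 'M[R[i]]_(d i, mu i)) : Prop :=
  (forall i j, conj_pair s i j -> conjugate_mx (K j) (K i)) /\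
  (forall i : 'I_nu, (s.*2 <= i)%N -> K i \is a mxOver Num.real).

(* diag(K_1, ..., K_nu); \mxdiag only accepts square blocks. *)
Definition K_mx (R : realType) (nu : nat) (d mu : 'I_nu -> nat)
    (K : forall i : 'I_nu, 'M[R[i]]_(d i, mu i)) :
    'M[R[i]]_(\sum_i d i, \sum_i mu i) :=
  \mxblock_(i, j)
    (if i == j then conform_mx 0 (K i) else 0 : 'M[R[i]]_(d i, mu j)).

(* M(K) = T K, before its column index type 'I_(\sum_i mu i) is identified
   with 'I_n. *)
Definition M_mx (R : realType) (n m nu : nat) (d mu : 'I_nu -> nat)
    (T : forall i : 'I_nu, 'M[R[i]]_(n + m, d i))
    (K : forall i : 'I_nu, 'M[R[i]]_(d i, mu i)) :
    'M[R[i]]_(n + m, \sum_i mu i) :=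
  (\mxrow_i T i) *m K_mx K.

(* [insubd i k] is the index k, and [conform_mx (blk i) (blk k)] is the block
   blk k seen with the size of blk i; the fallback values i and blk i are used
   only if k >= nu or mu k != mu i, which does not occur when 2s <= nu and
   paired multiplicities agree. *)
Definition ReM_cplx (R : realType) (p nu s : nat) (mu : 'I_nu -> nat)
    (M : 'M[R[i]]_(p, \sum_i mu i)) : 'M[R[i]]_(p, \sum_i mu i) :=
  let blk (i : 'I_nu) := submxrow M i in
  let blk_at (i : 'I_nu) (k : nat) := conform_mx (blk i) (blk (insubd i k)) in
  \mxrow_i
    (if (i < s.*2)%N then
       if odd i then (2 * 'i%C)^-1 *: (blk_at i i.-1 - blk i)
       else 2^-1 *: (blk i + blk_at i i.+1)
     else blk i).

(* For admissible K all entries of ReM_cplx s (M_mx T K) are real, so that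
   complex.Re only changes their type here. *)
Definition ReM_mx (R : realType) (p nu s : nat) (mu : 'I_nu -> nat)
    (M : 'M[R[i]]_(p, \sum_i mu i)) : 'M[R]_(p, \sum_i mu i) :=
  map_mx (@complex.Re R) (ReM_cplx s M).

Definition X_mx (R : realType) (n m nu : nat) (d mu : 'I_nu -> nat)
    (hn : (\sum_i mu i)%N = n)
    (T : forall i : 'I_nu, 'M[R[i]]_(n + m, d i))
    (K : forall i : 'I_nu, 'M[R[i]]_(d i, mu i)) : 'M[R[i]]_n :=
  castmx (erefl n, hn) (usubmx (M_mx T K)).

Definition V_mx (R : realType) (n m nu s : nat) (d mu : 'I_nu -> nat)
    (hn : (\sum_i mu i)%N = n)
    (T : forall i : 'I_nu, 'M[R[i]]_(n + m, d i))
    (K : forall i : 'I_nu, 'M[R[i]]_(d i, mu i)) : 'M[R]_n :=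
  castmx (erefl n, hn) (usubmx (ReM_mx s (M_mx T K))).

Definition W_mx (R : realType) (n m nu s : nat) (d mu : 'I_nu -> nat)
    (hn : (\sum_i mu i)%N = n)
    (T : forall i : 'I_nu, 'M[R[i]]_(n + m, d i))
    (K : forall i : 'I_nu, 'M[R[i]]_(d i, mu i)) : 'M[R]_(m, n) :=
  castmx (erefl m, hn) (dsubmx (ReM_mx s (M_mx T K))).

(* Lebesgue measure on R^k, as an iterated product. *)
Fixpoint lebesgue_tuple (R : realType) (k : nat) :
    set (k.-tuple (measurableTypeR R)) -> \bar R :=
  match k with
  | 0 => dirac [tuple]
  | k'.+1 =>
      pushforward (@lebesgue_measure R \x @lebesgue_tuple R k')%E
        (fun p : measurableTypeR R * k'.-tuple (measurableTypeR R) =>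
           [tuple of p.1 :: p.2])
  end.

(* The real coordinates of an admissible K: Re K_i and Im K_{i+1} for each
   conjugate pair {i, i+1}, and K_i itself for i beyond the pairs.  This is a
   linear isomorphism from the real vector space of admissible K onto R^k,
   where k = \sum_i d i * mu i. *)
Definition param_coords (R : realType) (nu s : nat) (d mu : 'I_nu -> nat)
    (K : forall i : 'I_nu, 'M[R[i]]_(d i, mu i)) :
    (\sum_i d i * mu i)%N.-tuple (measurableTypeR R) :=
  let coords : 'rV[R]_(\sum_i d i * mu i) :=
    \mxrow_(i < nu)
      mxvec (if (i < s.*2)%N && odd i then map_mx (@complex.Im R) (K i)
             else map_mx (@complex.Re R) (K i)) in
  [tuple coords ord0 k | k < (\sum_i d i * mu i)%N].

Definition for_almost_every_K (R : realType) (nu s : nat)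
    (d mu : 'I_nu -> nat)
    (P : (forall i : 'I_nu, 'M[R[i]]_(d i, mu i)) -> Prop) : Prop :=
  negligible (@lebesgue_tuple R (\sum_i d i * mu i)%N)
    [set param_coords s K | K in [set K | admissible s K /\ ~ P K]].

(* Main.v *)
Require Import Defs.
From HB Require Import structures.
From mathcomp Require Import all_boot all_order all_algebra.
From mathcomp Require Import all_classical all_reals all_analysis.
From mathcomp Require Import measurable_realfun complex.
From mathcomp Require polyrcf.

Set Implicit Arguments.
Unset Strict Implicit.
Unset Printing Implicit Defensive.

Import Order.TTheory GRing.Theory Num.Theory.

Local Open Scope classical_set_scope.
Local Open Scope ring_scope.

(** Both assertions rest on one reading of [M_mx T K]: its [i]-th block
    [T i *m K i] lists [mu i] vectors of the nullspace of
    [S_mx A B (lam i)], and for a vector with upper part [x] and lower part [y]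
    membership in this nullspace says [A x + B y = lam i x].  Hence, writing
    [X] and [Y] for the upper and lower parts of [M_mx T K], one always has
    [A X + B Y = X Lambda] (lemma [M_mx_closed_loop]); if [X] is invertible, the
    unique [F] with [F X = Y] satisfies [(A + B F) X = X Lambda], and the
    columns of [X] may be rescaled to unit length because the rescaling and
    [Lambda] are both diagonal ([solves_EPP_unnormalized]).

    The real matrices [V] and [W] enter because the passage from [M] to
    [ReM_cplx s M] is an invertible operation on columns.  It therefore commutes
    with every multiplication from the left ([mul_ReM_cplx]) and kills only [0]
    ([ReM_cplx_eq0]), and for admissible parameters its result is real
    ([cplx_ReM_mx]).  So [V] is invertible whenever [X] is, and
    [F X = Y] is equivalent to [F V = W], that is to [F = W V^-1]
    ([V_mx_unit], [gain_mxE]).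

    Conversely, let a real [F] solve the equation.  The eigenvectors given by the
    equation need not be conjugate or real, but since [A + B F] is real they can
    be replaced by the conjugates of their partners and, for a real
    eigenvalue, by a real basis of as many vectors ([selfconj_eigenblocks]).
    Stacking these vectors [z] with [F z] gives nullspace vectors, whose
    coordinates with respect to [T i] form an admissible [K]
    ([solves_EPP_param]); the vectors remain independent because eigenspaces for
    distinct eigenvalues are in direct sum ([mxrow_eigen_unit]).

    For the almost-everywhere assertion, [\det X] is a polynomial in the real
    coordinates of [K], and it does not vanish at the parameter that the previous
    construction attaches to a given solution.  The zero set of a nonzero
    polynomial on [R^k] is a null set, by induction on [k] and integration of
    the measures of the slices ([lebesgue_tuple_zeros]). *)

(** * Zero sets of polynomial functions are null sets *)

(** Closing constants and coordinates under the ring operations yields all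
    polynomial functions, and every fact needed below is a structural induction;
    no normal form of multivariate polynomials is involved. *)
Inductive polyfun (R : realType) (k : nat) :
    (k.-tuple (measurableTypeR R) -> R) -> Prop :=
| polyfun_cst c : polyfun (fun=> c)
| polyfun_coord j : polyfun (fun t => tnth t j)
| polyfunD f g : polyfun f -> polyfun g -> polyfun (fun t => f t + g t)
| polyfunM f g : polyfun f -> polyfun g -> polyfun (fun t => f t * g t).

Lemma polyfun_measurable (R : realType) (k : nat)
    (f : k.-tuple (measurableTypeR R) -> R) :
  polyfun f -> measurable_fun setT (f : _ -> measurableTypeR R).
Proof.
elim=> [c|j|{}f g _ mf _ mg|{}f g _ mf _ mg].
- exact: measurable_cst.
- exact: measurable_tnth.
- exact: measurable_funD.
- exact: measurable_funM.
Qed.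

Lemma polyfun_tail (R : realType) (k : nat) (x : R)
    (f : k.+1.-tuple (measurableTypeR R) -> R) :
  polyfun f ->
  polyfun (fun t : k.-tuple (measurableTypeR R) => f [tuple of x :: t]).
Proof.
elim=> [c|j|{}f g _ pf _ pg|{}f g _ pf _ pg].
- exact: polyfun_cst.
- case: (unliftP ord0 j) => [j' ->|->].
  + rewrite (_ : (fun _ => _) = (fun t => tnth t j')).
      exact: polyfun_coord.
    by apply/funext => t; rewrite tnthS.
  + exact: polyfun_cst.
- exact: polyfunD.
- exact: polyfunM.
Qed.

Lemma polyfun_head (R : realType) (k : nat) (t : k.-tuple (measurableTypeR R))
    (f : k.+1.-tuple (measurableTypeR R) -> R) :
  polyfun f -> exists q : {poly R}, forall x : R, f [tuple of x :: t] = q.[x].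
Proof.
elim=> [c|j|{}f g _ [p pE] _ [q qE]|{}f g _ [p pE] _ [q qE]].
- by exists c%:P => x; rewrite hornerC.
- case: (unliftP ord0 j) => [j' ->|->].
  + by exists (tnth t j')%:P => x; rewrite tnthS hornerC.
  + by exists 'X => x; rewrite hornerX.
- by exists (p + q) => x; rewrite hornerD pE qE.
- by exists (p * q) => x; rewrite hornerM pE qE.
Qed.

Lemma lebesgue_tuple_cons (R : realType) (k : nat)
    (A : set (k.+1.-tuple (measurableTypeR R))) :
  lebesgue_tuple A =
  (\int[@lebesgue_measure R]_x lebesgue_tuple
     [set t : k.-tuple (measurableTypeR R) | A [tuple of x :: t]])%E.
Proof.
rewrite /= /pushforward /product_measure1; apply: eq_integral => x _ /=.
by congr lebesgue_tuple; apply/seteqP; split=> t; rewrite /xsection /= inE.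
Qed.

Lemma finite_poly_zeros (R : realType) (q : {poly R}) :
  q != 0 -> finite_set [set x | q.[x] = 0].
Proof.
move=> q0; apply: (sub_finite_set _ (finite_seq (polyrcf.rootsR q))) => x /= qx0.
by rewrite -polyrcf.roots_on_rootsR //= rootE qx0 eqxx.
Qed.

(** Let [F] be the set of those first coordinates [x] for which [f (x :: _)]
    vanishes identically.  It is finite, since [f (_ :: behead t0)] is a
    nonzero univariate polynomial vanishing on [F], and for every [x] outside
    [F] the slice is null by induction.  The measure of the slice is thus an
    explicit function of [x], a constant times the indicator of [F]; this makes
    it measurable without any appeal to sigma-finiteness. *)
Lemma lebesgue_tuple_zeros (R : realType) (k : nat)
    (f : k.-tuple (measurableTypeR R) -> R)
    (t0 : k.-tuple (measurableTypeR R)) :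
  polyfun f -> f t0 != 0 -> lebesgue_tuple [set t | f t = 0] = 0%E.
Proof.
elim: k f t0 => [|k IH] f t0 pf ft0.
  rewrite /= diracE (_ : _ \in _ = false) //.
  apply/negbTE; rewrite notin_setE /=.
  by move/eqP; rewrite (tuple0 t0) in ft0; apply/negP.
rewrite lebesgue_tuple_cons.
pose F : set (measurableTypeR R) :=
  [set x | forall t : k.-tuple (measurableTypeR R), f [tuple of x :: t] = 0].
have finF : finite_set F.
  have [q qE] := polyfun_head [tuple of behead t0] pf.
  apply: (@sub_finite_set _ _ [set x | q.[x] = 0]) => [x Fx /=|].
    by rewrite -qE Fx.
  apply: finite_poly_zeros; apply: contraNneq ft0 => q0.
  by rewrite (tuple_eta t0) qE q0 horner0.
have mF : measurable F.
  by apply: countable_measurable => //; exact: finite_set_countable.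
have slice x :
    lebesgue_tuple [set t : k.-tuple (measurableTypeR R) |
                     f [tuple of x :: t] = 0] =
    (lebesgue_tuple [set: k.-tuple (measurableTypeR R)] * (\1_F x)%:E)%E.
  rewrite indicE; case: (boolP (x \in F)); rewrite ?inE ?notin_setE => Fx.
    rewrite mule1; congr lebesgue_tuple.
    by apply/seteqP; split=> t // _; exact: Fx.
  rewrite mule0; have /existsNP [t /eqP ft] := Fx.
  exact: IH (polyfun_tail x pf) ft.
under eq_integral do rewrite slice.
have mI : measurable_fun setT
    (fun x : measurableTypeR R => (\1_F x)%:E : \bar R).
  by apply/measurable_EFinP; exact: measurable_indic.
rewrite (@ae_eq_integral _ _ _ (@lebesgue_measure R) setT (cst 0%E)) //.
- exact: integral0.
- exact: measurable_funeM.
- exists F; split=> //.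
    exact/countable_lebesgue_measure0/finite_set_countable.
  move=> x /= H; apply: contrapT => Fx; apply: H => _.
  by rewrite indicE memNset // mule0.
Qed.

Lemma polyfun_negligible (R : realType) (k : nat)
    (f : k.-tuple (measurableTypeR R) -> R)
    (t0 : k.-tuple (measurableTypeR R)) (N : set _) :
  polyfun f -> f t0 != 0 -> (forall t, N t -> f t = 0) ->
  negligible (@lebesgue_tuple R k) N.
Proof.
move=> pf ft0 fN; exists [set t | f t = 0]; split=> //.
  have := polyfun_measurable pf measurableT (measurable_set1 (0 : R)).
  by rewrite setTI.
exact: lebesgue_tuple_zeros pf ft0.
Qed.

(** * Conjugate pairs of indices and conjugate matrices *)

Lemma conj_pair_odd (nu s : nat) (i j : 'I_nu) :
  conj_pair s i j -> [/\ ~~ odd i, odd j, (i < s.*2)%N & (j < s.*2)%N].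
Proof.
move=> /and3P[oi ilt /eqP ej]; rewrite ej /= oi ilt; split=> //.
(* [i] is even and [s.*2] is even, so [i.+1 = s.*2] is excluded by parity. *)
rewrite ltn_neqAle ilt andbT; apply: contraNneq oi => E.
by rewrite -[odd i]negbK -/(odd i.+1) E odd_double.
Qed.

Lemma conj_pair_partner (nu s : nat) (hs : (s.*2 <= nu)%N) (i : 'I_nu) :
  (i < s.*2)%N ->
  (~~ odd i /\ exists j : 'I_nu, conj_pair s i j) \/
  (odd i /\ exists j : 'I_nu, conj_pair s j i).
Proof.
move=> ilt; have [oi|oi] := boolP (odd i); [right | left]; split=> //.
  have ltj : (i.-1 < nu)%N.
    by apply: leq_ltn_trans (ltn_ord i); exact: leq_pred.
  exists (Ordinal ltj); rewrite /conj_pair /=.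
  case: (nat_of_ord i) oi ilt => //= k ok ksn.
  by rewrite ok eqxx (ltnW ksn).
have ltj : (i.+1 < nu)%N.
  apply: leq_trans hs; rewrite ltn_neqAle ilt andbT.
  apply: contraNneq oi => E.
  by rewrite -[odd i]negbK -/(odd i.+1) E odd_double.
by exists (Ordinal ltj); rewrite /conj_pair /= oi ilt eqxx.
Qed.

Lemma conjugate_mx_sym (R : realType) (p q p' q' : nat)
    (M : 'M[R[i]]_(p, q)) (M' : 'M[R[i]]_(p', q')) :
  conjugate_mx M M' -> conjugate_mx M' M.
Proof.
move=> [[e1 e2] ->]; subst p' q'; rewrite castmx_id.
exists (erefl, erefl); rewrite castmx_id; apply/matrixP => x y.
by rewrite !mxE conjcK.
Qed.

Lemma conjugate_mxM (R : realType) (p a b a' b' : nat)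
    (T : 'M[R[i]]_(p, a)) (T' : 'M[R[i]]_(p, a'))
    (K : 'M[R[i]]_(a, b)) (K' : 'M[R[i]]_(a', b')) :
  conjugate_mx T T' -> conjugate_mx K K' -> conjugate_mx (T *m K) (T' *m K').
Proof.
move=> [[e1 e2] ->] [[e3 e4] ->]; subst a' b'.
rewrite (eq_irrelevance e1 erefl) (eq_irrelevance e3 erefl) !castmx_id.
by exists (erefl, erefl); rewrite castmx_id /conj_mx map_mxM.
Qed.

Lemma conj_mx_real (R : realType) (p q : nat) (M : 'M[R[i]]_(p, q)) :
  M \is a mxOver Num.real <-> conj_mx M = M.
Proof.
split=> [/mxOverP H|H].
  by apply/matrixP => x y; rewrite mxE -(RRe_real (H x y)) conjc_real.
apply/mxOverP => x y; move/matrixP/(_ x y): H; rewrite mxE.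
case: (M x y) => u v /= [vE]; rewrite complex_real.
by have := mulrn_eq0 v 2; rewrite /= => <-; rewrite mulr2n -{2}vE addrN.
Qed.

Lemma row_free_tr_cancel (F : fieldType) (p a b : nat)
    (T : 'M[F]_(p, a)) (K K' : 'M[F]_(a, b)) :
  row_free T^T -> T *m K = T *m K' -> K = K'.
Proof.
move=> fT E; apply: trmx_inj; apply: (row_free_inj fT).
by rewrite -!trmx_mul E.
Qed.

(** Coordinates with respect to conjugate bases of conjugate vectors are
    conjugate; this and the next lemma make the coordinates found for a given
    gain matrix admissible. *)
Lemma conjugate_mx_cancel (R : realType) (p a b a' b' : nat)
    (T : 'M[R[i]]_(p, a)) (T' : 'M[R[i]]_(p, a'))
    (K : 'M[R[i]]_(a, b)) (K' : 'M[R[i]]_(a', b')) :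
  row_free T'^T ->
  conjugate_mx T T' -> conjugate_mx (T *m K) (T' *m K') -> conjugate_mx K K'.
Proof.
move=> fT [[e1 e2] TE] [[e3 e4] E]; subst a' b'.
move: TE E fT.
rewrite (eq_irrelevance e1 erefl) (eq_irrelevance e3 erefl) !castmx_id => ->.
rewrite /conj_mx map_mxM => E fT; exists (erefl, erefl); rewrite castmx_id.
exact: row_free_tr_cancel fT E.
Qed.

Lemma real_mx_cancel (R : realType) (p a b : nat)
    (T : 'M[R[i]]_(p, a)) (K : 'M[R[i]]_(a, b)) :
  row_free T^T -> T \is a mxOver Num.real -> T *m K \is a mxOver Num.real ->
  K \is a mxOver Num.real.
Proof.
move=> fT /conj_mx_real rT /conj_mx_real rTK; apply/conj_mx_real.
apply: (row_free_tr_cancel fT); rewrite -{1}rT -[RHS]rTK.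
by rewrite /conj_mx map_mxM.
Qed.

(** * Polynomials in the real coordinates of the admissible parameters *)

Section CoordPoly.
Variables (R : realType) (nu s : nat) (d mu : 'I_nu -> nat).
Local Notation params := (forall i : 'I_nu, 'M[R[i]]_(d i, mu i)).

Definition coord_poly (h : params -> R[i]) : Prop :=
  exists f g, [/\ polyfun f, polyfun g & forall K, admissible s K ->
    h K = Complex (f (param_coords s K)) (g (param_coords s K))].

Lemma eq_coord_poly h h' : h =1 h' -> coord_poly h -> coord_poly h'.
Proof. by move=> /funext ->. Qed.

Lemma coord_poly_cst c : coord_poly (fun=> c).
Proof.
exists (fun=> complex.Re c), (fun=> complex.Im c).
by split; [exact: polyfun_cst | exact: polyfun_cst | case: c].
Qed.

Lemma coord_polyD h h' :
  coord_poly h -> coord_poly h' -> coord_poly (fun K => h K + h' K).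
Proof.
move=> [f [g [pf pg E]]] [f' [g' [pf' pg' E']]].
exists (fun t => f t + f' t), (fun t => g t + g' t).
by split; [exact: polyfunD | exact: polyfunD | move=> K aK; rewrite E // E'].
Qed.

Lemma coord_polyM h h' :
  coord_poly h -> coord_poly h' -> coord_poly (fun K => h K * h' K).
Proof.
move=> [f [g [pf pg E]]] [f' [g' [pf' pg' E']]].
exists (fun t => f t * f' t + -1 * (g t * g' t)).
exists (fun t => f t * g' t + g t * f' t).
split; [| |by move=> K aK; rewrite E // E' // mulN1r].
- by apply: polyfunD; [|apply: polyfunM; first exact: polyfun_cst];
    exact: polyfunM.
- by apply: polyfunD; exact: polyfunM.
Qed.

Lemma coord_poly_sum I (r : seq I) (P : pred I) (F : I -> params -> R[i]) :
  (forall i, coord_poly (F i)) ->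
  coord_poly (fun K => \sum_(i <- r | P i) F i K).
Proof.
move=> pF; elim: r => [|i r IH].
  by apply: eq_coord_poly (coord_poly_cst 0) => K; rewrite big_nil.
case Pi: (P i).
  by apply: eq_coord_poly (coord_polyD (pF i) IH) => K; rewrite big_cons Pi.
by apply: eq_coord_poly IH => K; rewrite big_cons Pi.
Qed.

Lemma coord_poly_prod I (r : seq I) (P : pred I) (F : I -> params -> R[i]) :
  (forall i, coord_poly (F i)) ->
  coord_poly (fun K => \prod_(i <- r | P i) F i K).
Proof.
move=> pF; elim: r => [|i r IH].
  by apply: eq_coord_poly (coord_poly_cst 1) => K; rewrite big_nil.
case Pi: (P i).
  by apply: eq_coord_poly (coord_polyM (pF i) IH) => K; rewrite big_cons Pi.
by apply: eq_coord_poly IH => K; rewrite big_cons Pi.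
Qed.

Lemma coord_poly_det p (F : params -> 'M[R[i]]_p) :
  (forall a b, coord_poly (fun K => F K a b)) ->
  coord_poly (fun K => \det (F K)).
Proof.
move=> pF; apply: coord_poly_sum => sg; apply: coord_polyM.
  exact: coord_poly_cst.
by apply: coord_poly_prod => a; exact: pF.
Qed.

Lemma tnth_param_coords (K : params) i a b :
  tnth (param_coords s K) (tagnat.Rank i (mxvec_index a b)) =
  if (i < s.*2)%N && odd i then complex.Im (K i a b) else complex.Re (K i a b).
Proof.
rewrite tnth_mktuple; set B := (X in (\mxrow_i X i) _ _).
have /matrixP/(_ ord0 (mxvec_index a b)) := mxrowK B i.
rewrite mxE => ->; rewrite /B mxvecE.
by case: ifP => _; rewrite mxE.
Qed.

(** Of a conjugate pair of blocks only the real part of the first and the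
    imaginary part of the second are coordinates; the two missing parts are,
    up to sign, coordinates of the partner.  The parameter [K0] serves only to
    identify the sizes of paired blocks. *)
Lemma coord_poly_entry (hs : (s.*2 <= nu)%N) (K0 : params) i a b :
  admissible s K0 -> coord_poly (fun K => K i a b).
Proof.
move=> [pK0 _].
pose co i a b := fun t : (\sum_i d i * mu i)%N.-tuple (measurableTypeR R) =>
  tnth t (tagnat.Rank i (@mxvec_index (d i) (mu i) a b)).
have pco i' a' b' : polyfun (@co i' a' b') by exact: polyfun_coord.
have [ilt|ige] := ltnP i s.*2; last first.
  exists (co i a b), (fun=> 0); split=> //; first exact: polyfun_cst.
  move=> K [_ /(_ i ige)/mxOverP/(_ a b)].
  rewrite /co tnth_param_coords ltnNge ige /=.
  by case: (K i a b) => x y; rewrite complex_real => /eqP ->.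
have [[_ [j ij]]|[_ [j ji]]] := conj_pair_partner hs ilt.
  have [oi oj _ jlt] := conj_pair_odd ij; have [[e1 e2] _] := pK0 _ _ ij.
  exists (co i a b).
  exists (fun t => -1 * co j (cast_ord (esym e1) a) (cast_ord (esym e2) b) t).
  split=> //; first by apply: polyfunM => //; exact: polyfun_cst.
  move=> K [/(_ i j ij) [[e1' e2'] E] _].
  rewrite /co !tnth_param_coords (negbTE oi) andbF jlt oj E.
  rewrite (eq_irrelevance e1' e1) (eq_irrelevance e2' e2) castmxE mxE.
  by case: (K j _ _) => x y /=; rewrite mulN1r.
have [oj oi _ _] := conj_pair_odd ji; have [[e1 e2] _] := pK0 _ _ ji.
exists (co j (cast_ord e1 a) (cast_ord e2 b)), (co i a b); split=> //.
move=> K [/(_ j i ji) [[e1' e2'] E] _].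
rewrite /co !tnth_param_coords oi ilt (negbTE oj) andbF E.
rewrite (eq_irrelevance e1' e1) (eq_irrelevance e2' e2) castmxE mxE !cast_ordK.
by case: (K i a b) => x y.
Qed.

Lemma coord_poly_negligible (h : params -> R[i]) (K0 : params) :
  coord_poly h -> admissible s K0 -> h K0 != 0 ->
  for_almost_every_K s (fun K => h K != 0).
Proof.
move=> [f [g [pf pg E]]] aK0 hK0.
have zero K : admissible s K -> ~ h K != 0 ->
    f (param_coords s K) = 0 /\ g (param_coords s K) = 0.
  by move=> aK /negP; rewrite negbK E // eq_complex /= => /andP[/eqP-> /eqP->].
(* One of the real and imaginary parts of [h] is a nonzero polynomial, and its
   zeros already form a null set. *)
move: hK0; rewrite E // eq_complex negb_and /= => /orP[nz|nz].
  by apply: polyfun_negligible pf nz _ => _ [K [aK hK] <-]; case: (zero K aK hK).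
by apply: polyfun_negligible pg nz _ => _ [K [aK hK] <-]; case: (zero K aK hK).
Qed.

End CoordPoly.

(** * The column operation producing real matrices *)

Lemma conform_mx_cast (V : Type) (p a b : nat)
    (N : 'M[V]_(p, b)) (A : 'M[V]_(p, a)) (e : a = b) :
  conform_mx N A = castmx (erefl p, e) A.
Proof. by subst b; rewrite conform_mx_id castmx_id. Qed.

Lemma mulmx_conform (F : pzSemiRingType) (p q a b : nat) (C : 'M[F]_(p, q))
    (N : 'M[F]_(q, a)) (N' : 'M[F]_(q, b)) :
  C *m conform_mx N N' = conform_mx (C *m N) (C *m N').
Proof.
have [E|ne] := eqVneq b a; last by rewrite !nonconform_mx ?ne ?orbT.
by subst b; rewrite !conform_mx_id.
Qed.

Section RealColumns.
Variables (R : realType) (nu s : nat) (mu : 'I_nu -> nat).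

Lemma mul_ReM_cplx (p q : nat) (C : 'M[R[i]]_(p, q))
    (M : 'M[R[i]]_(q, \sum_i mu i)) :
  ReM_cplx s (C *m M) = C *m ReM_cplx s M.
Proof.
rewrite /ReM_cplx mul_mxrow; apply: eq_mxrow => i.
rewrite -!mul_submxrow -!mulmx_conform.
case: ifP => // _; case: ifP => _; rewrite -scalemxAr.
  by rewrite mulmxBr.
by rewrite mulmxDr.
Qed.

Lemma ReM_cplx_usubmx (p q : nat) (M : 'M[R[i]]_(p + q, \sum_i mu i)) :
  ReM_cplx s (usubmx M) = usubmx (ReM_cplx s M).
Proof. by rewrite !usubmxEsub rowsubE mul_ReM_cplx -rowsubE. Qed.

Lemma ReM_cplx_dsubmx (p q : nat) (M : 'M[R[i]]_(p + q, \sum_i mu i)) :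
  ReM_cplx s (dsubmx M) = dsubmx (ReM_cplx s M).
Proof. by rewrite !dsubmxEsub rowsubE mul_ReM_cplx -rowsubE. Qed.

Lemma ReM_cplx_fst (p : nat) (M : 'M[R[i]]_(p, \sum_i mu i))
    (i j : 'I_nu) (e : mu j = mu i) :
  conj_pair s i j ->
  submxrow (ReM_cplx s M) i =
  2^-1 *: (submxrow M i + castmx (erefl p, e) (submxrow M j)).
Proof.
move=> ij; have [oi _ ilt _] := conj_pair_odd ij; case/and3P: ij => _ _ /eqP ej.
rewrite mxrowK ilt (negbTE oi) -(conform_mx_cast (submxrow M i)).
have -> // : insubd i i.+1 = j by apply: val_inj; rewrite val_insubd -ej ltn_ord.
Qed.

Lemma ReM_cplx_snd (p : nat) (M : 'M[R[i]]_(p, \sum_i mu i))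
    (i j : 'I_nu) (e : mu i = mu j) :
  conj_pair s i j ->
  submxrow (ReM_cplx s M) j =
  (2 * 'i%C)^-1 *: (castmx (erefl p, e) (submxrow M i) - submxrow M j).
Proof.
move=> ij; have [_ oj _ jlt] := conj_pair_odd ij; case/and3P: ij => _ _ /eqP ej.
rewrite mxrowK jlt oj -(conform_mx_cast (submxrow M j)).
have -> // : insubd j j.-1 = i.
by apply: val_inj; rewrite val_insubd ej /= ltn_ord.
Qed.

Lemma ReM_cplx_real (p : nat) (M : 'M[R[i]]_(p, \sum_i mu i)) (i : 'I_nu) :
  (s.*2 <= i)%N -> submxrow (ReM_cplx s M) i = submxrow M i.
Proof. by move=> ige; rewrite mxrowK ltnNge ige. Qed.

Hypothesis hs : (s.*2 <= nu)%N.

(** The sum and the difference of two paired blocks determine both blocks. *)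
Lemma ReM_cplx_eq0 (p : nat) (M : 'M[R[i]]_(p, \sum_i mu i)) :
  (forall i j, conj_pair s i j -> mu j = mu i) ->
  ReM_cplx s M = 0 -> M = 0.
Proof.
move=> hmu M0.
have pair i j : conj_pair s i j -> submxrow M i = 0 /\ submxrow M j = 0.
  move=> ij; have e := hmu i j ij.
  have := ReM_cplx_fst M e ij; have := ReM_cplx_snd M (esym e) ij.
  rewrite M0 !submxrow0 => /esym/eqP.
  rewrite scaler_eq0 invr_eq0 mulf_eq0 pnatr_eq0 /=.
  rewrite eq_complex /= eqxx oner_eq0 /= subr_eq0 => /eqP ej.
  move=> /esym/eqP.
  rewrite scaler_eq0 invr_eq0 pnatr_eq0 /= -ej castmx_comp castmx_id.
  rewrite -mulr2n -scaler_nat scaler_eq0 pnatr_eq0 /= => /eqP i0.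
  by split=> //; rewrite i0; case: _ / (esym e); rewrite castmx_id.
rewrite -[M]submxrowK -[RHS](mxrow0 p); apply: eq_mxrow => i.
have [ilt|ige] := ltnP i s.*2; last by rewrite -ReM_cplx_real // M0 submxrow0.
by have [[_ [j /pair[]]]|[_ [j /pair[]]]] := conj_pair_partner hs ilt.
Qed.

Lemma cplx_ReM_mx (p : nat) (M : 'M[R[i]]_(p, \sum_i mu i)) :
  (forall i j, conj_pair s i j ->
    conjugate_mx (submxrow M i) (submxrow M j)) ->
  (forall i : 'I_nu, (s.*2 <= i)%N -> submxrow M i \is a mxOver Num.real) ->
  cplx_mx (ReM_mx s M) = ReM_cplx s M.
Proof.
move=> hpair hreal.
have pair i j : conj_pair s i j ->
    (submxrow (ReM_cplx s M) i \is a mxOver Num.real) /\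
    (submxrow (ReM_cplx s M) j \is a mxOver Num.real).
  move=> ij; have [[e1 e2] E] := hpair i j ij.
  rewrite (ReM_cplx_fst M (esym e2) ij) (ReM_cplx_snd M e2 ij) E.
  rewrite (eq_irrelevance e1 erefl) {e1 E}; move: (mu j) e2 => mj e2.
  case: _ / e2; rewrite !castmx_id; split; apply/mxOverP => a b; rewrite !mxE.
    by rewrite mulrC -ReJ_add; apply/complex_realP; eexists.
  rewrite subcJ [X in _^-1 * X](_ : _ =
    2 * 'i%C * (complex.Im (submxrow M i a b))%:C%C).
    rewrite mxE mulKf; first by apply/complex_realP; eexists.
    by rewrite mulf_eq0 pnatr_eq0 /= eq_complex /= eqxx oner_eq0.
  by rewrite mxE mulrAC.
have real i : submxrow (ReM_cplx s M) i \is a mxOver Num.real.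
  have [ilt|ige] := ltnP i s.*2; last by rewrite ReM_cplx_real // hreal.
  by have [[_ [j /pair[]]]|[_ [j /pair[]]]] := conj_pair_partner hs ilt.
apply/matrixP => a b; rewrite !mxE.
have /mxOverP/(_ a (tagnat.sig2 b)) := real (tagnat.sig1 b).
by rewrite mxrowK => /RRe_real.
Qed.

End RealColumns.

(** * Block columns, nullspaces and eigenvectors *)

Lemma usubmx_mxrow (V : Type) (nu p q : nat) (mu : 'I_nu -> nat)
    (N : forall i, 'M[V]_(p + q, mu i)) :
  usubmx (\mxrow_i N i) = \mxrow_i usubmx (N i).
Proof. by apply/matrixP => a b; rewrite !mxE. Qed.

Lemma dsubmx_mxrow (V : Type) (nu p q : nat) (mu : 'I_nu -> nat)
    (N : forall i, 'M[V]_(p + q, mu i)) :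
  dsubmx (\mxrow_i N i) = \mxrow_i dsubmx (N i).
Proof. by apply/matrixP => a b; rewrite !mxE. Qed.

Lemma M_mxE (R : realType) (n m nu : nat) (d mu : 'I_nu -> nat)
    (T : forall i : 'I_nu, 'M[R[i]]_(n + m, d i))
    (K : forall i : 'I_nu, 'M[R[i]]_(d i, mu i)) :
  M_mx T K = \mxrow_i (T i *m K i).
Proof.
rewrite /M_mx /K_mx mul_mxrow_mxblock; apply: eq_mxrow => j.
rewrite (bigD1 j) //= eqxx conform_mx_id big1 ?addr0 // => i /negbTE ->.
by rewrite mulmx0.
Qed.

Lemma S_mx_mul (R : realType) (n m p : nat) (A : 'M[R]_n) (B : 'M[R]_(n, m)) z
    (N : 'M[R[i]]_(n + m, p)) :
  S_mx A B z *m N =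
  cplx_mx A *m usubmx N + cplx_mx B *m dsubmx N - z *: usubmx N.
Proof.
rewrite -{1}[N]vsubmxK /S_mx mul_row_col mulmxBl mul_scalar_mx.
by rewrite addrAC.
Qed.

Lemma nullspace_basis_mul (F : fieldType) (p q a : nat)
    (S : 'M[F]_(p, q)) (T : 'M[F]_(q, a)) :
  nullspace_basis S T -> S *m T = 0.
Proof.
move=> [_ E]; apply: trmx_inj; rewrite trmx_mul trmx0; apply/sub_kermxP.
by rewrite E.
Qed.

Lemma nullspace_basis_lift (F : fieldType) (p q a b : nat)
    (S : 'M[F]_(p, q)) (T : 'M[F]_(q, a)) (M : 'M[F]_(q, b)) :
  nullspace_basis S T -> S *m M = 0 -> exists K, M = T *m K.
Proof.
move=> [_ E] SM0; have : (M^T <= T^T)%MS.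
  by rewrite E; apply/sub_kermxP; rewrite -trmx_mul SM0 trmx0.
move=> /submxP[D MD]; exists D^T.
by apply: trmx_inj; rewrite MD trmx_mul trmxK.
Qed.

Lemma row_free_sub_exists (F : fieldType) (p n r : nat) (A : 'M[F]_(p, n)) :
  (r <= \rank A)%N -> exists2 U : 'M[F]_(r, n), row_free U & (U <= A)%MS.
Proof.
move=> rA; exists (pid_mx r *m row_base A).
  by rewrite /row_free mxrankMfree ?row_base_free // rank_pid_mx.
by apply: submx_trans (submxMl _ _) _; rewrite eq_row_base.
Qed.

Lemma submxrow_free (F : fieldType) (nu : nat) (mu : 'I_nu -> nat)
    (X : 'M[F]_(\sum_i mu i)) i :
  X \in unitmx -> row_free (submxrow X i)^T.
Proof.
move=> uX; apply/row_freeP; exists (submxcol (invmx X) i)^T.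
rewrite -trmx_mul mul_submxrow submxcol_mul -submxblockEv mulVmx //.
by rewrite -mxdiagZ submxblock_diag trmx1.
Qed.

(** The blocks span subspaces of distinct eigenspaces, so their sum is direct
    and its dimension is the total number of columns. *)
Lemma mxrow_eigen_unit (F : fieldType) (nu : nat)
    (lam : 'I_nu -> F) (mu : 'I_nu -> nat)
    (G : 'M[F]_(\sum_i mu i)) (Z : forall i, 'M[F]_(\sum_i mu i, mu i)) :
  injective lam -> (forall i, row_free (Z i)^T) ->
  (forall i, G *m Z i = lam i *: Z i) -> \mxrow_i Z i \in unitmx.
Proof.
move=> injl fZ GZ; rewrite -unitmx_tr -row_full_unit /row_full.
rewrite tr_mxrow eqmx_col.
have sub i : (<<(Z i)^T>> <= eigenspace G^T (lam i))%MS.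
  by rewrite genmxE; apply/eigenspaceP; rewrite -trmx_mul GZ linearZ.
have dx : mxdirect (\sum_i <<(Z i)^T>>).
  apply/mxdirect_sumsP => i _; apply/eqP; rewrite -submx0.
  have /mxdirect_sumsP/(_ i isT) E :=
    @mxdirect_sum_eigenspace _ _ _ G^T predT lam (in2W injl).
  rewrite -[X in (_ <= X)%MS]E; apply: capmxS => //.
  by apply/sumsmx_subP => j ji; exact: sumsmx_sup (sub j).
rewrite (mxdirectP dx) /=; apply/eqP; apply: eq_bigr => i _.
by rewrite genmxE; exact/eqP/fZ.
Qed.

(** A real matrix maps conjugates of eigenvectors to conjugates, which settles
    the pairs.  For a real eigenvalue the independent complex eigenvectors
    [Y i] themselves are of no use: they only bound the dimension of the complex
    eigenspace from below, and the real eigenspace has the same dimension,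
    rank being invariant under field extension. *)
Lemma selfconj_eigenblocks (R : realType) (p nu s : nat) (mu : 'I_nu -> nat)
    (H : 'M[R]_p) (lam : 'I_nu -> R[i]) (Y : forall i, 'M[R[i]]_(p, mu i)) :
  (s.*2 <= nu)%N ->
  (forall i j, conj_pair s i j -> mu j = mu i) ->
  (forall i j, conj_pair s i j -> lam j = (lam i)^*%C) ->
  (forall i : 'I_nu, (s.*2 <= i)%N -> lam i \is Num.real) ->
  (forall i, row_free (Y i)^T) ->
  (forall i, cplx_mx H *m Y i = lam i *: Y i) ->
  exists Z : forall i, 'M[R[i]]_(p, mu i),
    [/\ forall i, row_free (Z i)^T /\ cplx_mx H *m Z i = lam i *: Z i,
        forall i j, conj_pair s i j -> conjugate_mx (Z i) (Z j)
      & forall i : 'I_nu, (s.*2 <= i)%N -> Z i \is a mxOver Num.real].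
Proof.
move=> hs hmu hlam hreal fY HY.
have realZ i : exists Z : 'M[R[i]]_(p, mu i), (s.*2 <= i)%N ->
    [/\ row_free Z^T, cplx_mx H *m Z = lam i *: Z & Z \is a mxOver Num.real].
  have [ige|] := leqP s.*2 i; last by exists 0.
  have /complex_realP[r lamr] := hreal i ige.
  have [U fU sU] :
      exists2 U : 'M[R]_(mu i, p), row_free U & (U <= eigenspace H^T r)%MS.
    apply: row_free_sub_exists.
    rewrite -(mxrank_map (real_complex R)) map_eigenspace.
    rewrite -{1}(eqP (fY i)); apply: mxrankS; apply/eigenspaceP.
    by rewrite -map_trmx -trmx_mul -/(cplx_mx H) HY linearZ /= lamr.
  have HU : H *m U^T = r *: U^T.
    by apply: trmx_inj; rewrite trmx_mul linearZ /= trmxK; exact/eigenspaceP.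
  exists (cplx_mx U^T) => _; split.
  - by rewrite /cplx_mx map_trmx trmxK row_free_map.
  - by rewrite /cplx_mx -map_mxM HU map_mxZ lamr.
  - by apply/mxOverP => a b; rewrite !mxE; apply/complex_realP; eexists.
pose Z (i : 'I_nu) : 'M[R[i]]_(p, mu i) :=
  if (i < s.*2)%N then
    if odd i then conform_mx (Y i) (conj_mx (Y (insubd i i.-1))) else Y i
  else projT1 (cid (realZ i)).
have Zr (i : 'I_nu) : (s.*2 <= i)%N ->
    [/\ row_free (Z i)^T, cplx_mx H *m Z i = lam i *: Z i
      & Z i \is a mxOver Num.real].
  move=> ige; have -> : Z i = projT1 (cid (realZ i)).
    by apply: ifF; rewrite ltnNge ige.
  by case: (cid _) => /= z; exact.
have Zp i j : conj_pair s i j ->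
    Z i = Y i /\
    exists e : mu i = mu j, Z j = castmx (erefl p, e) (conj_mx (Y i)).
  move=> ij; have [oi oj ilt jlt] := conj_pair_odd ij.
  rewrite /Z ilt jlt oj (negbTE oi); split=> //; exists (esym (hmu i j ij)).
  have -> : insubd j j.-1 = i; last exact: conform_mx_cast.
  case/and3P: ij => _ _ /eqP ej.
  by apply: val_inj; rewrite val_insubd ej /= ltn_ord.
exists Z; split=> [i|i j /Zp[-> [e ->]]|i /Zr[]] //; last by exists (erefl, e).
have [ilt|ige] := ltnP i s.*2; last by have [] := Zr i ige.
have [[_ [j ij]]|[_ [j ji]]] := conj_pair_partner hs ilt.
  by have [-> _] := Zp i j ij.
have [_ [e ->]] := Zp j i ji; rewrite (hlam j i ji).
move: (mu i) e => k e; case: _ / e; rewrite castmx_id; split.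
  by rewrite /conj_mx map_trmx row_free_map.
rewrite -[RHS]map_mxZ -HY map_mxM; congr (_ *m _).
by apply/matrixP => a b; rewrite !mxE; exact/esym/conjc_real.
Qed.

(** * Gain matrices and admissible parameters *)

Section Gains.
Variables (R : realType) (m nu s : nat) (mu : 'I_nu -> nat).
Local Notation n := (\sum_i mu i)%N.
Variables (A : 'M[R]_n) (B : 'M[R]_(n, m)) (lam : 'I_nu -> R[i]).

Lemma Lambda_mx_diag : Lambda_mx lam mu = diag_mx (\mxrow_i const_mx (lam i)).
Proof. by rewrite diag_mxrow; apply: eq_mxdiag => i; rewrite diag_const_mx. Qed.

Lemma mul_Lambda_mxP p (G : 'M[R[i]]_p) (X : 'M[R[i]]_(p, n)) :
  G *m X = X *m Lambda_mx lam mu ->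
  forall i, G *m submxrow X i = lam i *: submxrow X i.
Proof.
move=> H i; rewrite mul_submxrow H -{1}[X]submxrowK mul_mxrow_mxdiag mxrowK.
by rewrite mul_mx_scalar.
Qed.

(** Dividing the columns of [X] by their norms multiplies it on the right by
    an invertible diagonal matrix, which commutes with [Lambda]. *)
Lemma solves_EPP_unnormalized (F : 'M[R]_(m, n)) (X : 'M[R[i]]_n) :
  X \in unitmx -> cplx_mx (A + B *m F) *m X = X *m Lambda_mx lam mu ->
  solves_EPP A B lam erefl F.
Proof.
move=> uX GX; pose N k := \sum_r `|X r k| ^+ 2.
have N0 k : N k != 0.
  apply/eqP => Nk0; have col0 r : X r k = 0.
    have /eqP := psumr_eq0P
      (fun r _ => exprn_ge0 2 (normr_ge0 (X r k))) Nk0 (i := r) isT.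
    by rewrite expf_eq0 /= normr_eq0 => /eqP.
  have := mulVmx uX; move=> /matrixP/(_ k k).
  rewrite !mxE eqxx big1 => [/esym/eqP|r _]; first by rewrite oner_eq0.
  by rewrite col0 mulr0.
have Nge0 k : 0 <= N k by apply: sumr_ge0 => r _; rewrite exprn_ge0.
pose D := diag_mx (\row_k (sqrtC (N k))^-1).
exists (X *m D); split.
- rewrite unitmx_mul uX /= unitmxE det_diag unitfE; apply/prodf_neq0 => k _.
  by rewrite mxE invr_eq0 sqrtC_eq0.
- move=> k; rewrite -(mulfV (N0 k)) {1}/N mulr_suml; apply: eq_bigr => r _.
  rewrite mul_mx_diag !mxE normrM normfV (ger0_norm (x := sqrtC _)).
    by rewrite exprMn exprVn sqrtCK.
  by rewrite sqrtC_ge0.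
- by rewrite castmx_id mulmxA GX Lambda_mx_diag -!mulmxA diag_mxC.
Qed.

Variables (d : 'I_nu -> nat) (T : forall i : 'I_nu, 'M[R[i]]_(n + m, d i)).
Hypothesis hs : (s.*2 <= nu)%N.
Hypothesis hmu : forall i j, conj_pair s i j -> mu j = mu i.
Hypothesis hT_pair : forall i j, conj_pair s i j -> conjugate_mx (T i) (T j).
Hypothesis hT_real :
  forall i : 'I_nu, (s.*2 <= i)%N -> T i \is a mxOver Num.real.
Hypothesis hT : forall i, nullspace_basis (S_mx A B (lam i)) (T i).

Section FixedParameter.
Variable K : forall i : 'I_nu, 'M[R[i]]_(d i, mu i).
Let X := usubmx (M_mx T K).
Let Y := dsubmx (M_mx T K).
Let V := V_mx s erefl T K.
Let W := W_mx s erefl T K.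

Lemma M_mx_closed_loop :
  cplx_mx A *m X + cplx_mx B *m Y = X *m Lambda_mx lam mu.
Proof.
rewrite /X /Y M_mxE usubmx_mxrow dsubmx_mxrow /Lambda_mx.
rewrite mul_mxrow_mxdiag !mul_mxrow -mxrowD.
apply: eq_mxrow => i; rewrite mul_mx_scalar.
apply/eqP; rewrite -subr_eq0 -S_mx_mul.
by rewrite mulmxA (nullspace_basis_mul (hT i)) mul0mx.
Qed.

Hypothesis aK : admissible s K.

Lemma cplx_ReM_M_mx : cplx_mx (ReM_mx s (M_mx T K)) = ReM_cplx s (M_mx T K).
Proof.
have [pK rK] := aK.
apply: cplx_ReM_mx => // [i j ij|i ige]; rewrite M_mxE !mxrowK.
  by apply: conjugate_mxM; [exact: hT_pair | exact/conjugate_mx_sym/pK].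
apply/conj_mx_real; rewrite /conj_mx map_mxM; congr (_ *m _).
  exact/conj_mx_real/hT_real.
exact/conj_mx_real/rK.
Qed.

Lemma cplx_V_mx : cplx_mx V = ReM_cplx s X.
Proof.
rewrite ReM_cplx_usubmx -cplx_ReM_M_mx /V /V_mx castmx_id.
by rewrite /cplx_mx map_usubmx.
Qed.

Lemma cplx_W_mx : cplx_mx W = ReM_cplx s Y.
Proof.
rewrite ReM_cplx_dsubmx -cplx_ReM_M_mx /W /W_mx castmx_id.
by rewrite /cplx_mx map_dsubmx.
Qed.

Hypothesis uX : X \in unitmx.

Lemma V_mx_unit : V \in unitmx.
Proof.
rewrite -(map_unitmx (real_complex R)) -/(cplx_mx V) cplx_V_mx.
rewrite -row_free_unit -kermx_eq0; apply/eqP.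
(* A matrix annihilating [V] from the left annihilates [X] as well. *)
have : ReM_cplx s (kermx (ReM_cplx s X) *m X) = 0.
  by rewrite mul_ReM_cplx mulmx_ker.
move=> /(ReM_cplx_eq0 hs hmu) /(congr1 (mulmx^~ (invmx X))).
by rewrite mulmxK // mul0mx.
Qed.

Lemma gain_mxE (F : 'M[R]_(m, n)) :
  W *m invmx V = F <-> cplx_mx F *m X = Y.
Proof.
have uV := V_mx_unit; split=> [E|E].
  have {E} FV : F *m V = W by rewrite -E mulmxKV.
  apply/eqP; rewrite -subr_eq0; apply/eqP/(ReM_cplx_eq0 hs hmu).
  have -> : cplx_mx F *m X - Y = row_mx (cplx_mx F) (- 1%:M) *m M_mx T K.
    by rewrite -[M_mx T K]vsubmxK mul_row_col mulNmx mul1mx.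
  rewrite mul_ReM_cplx -[ReM_cplx _ _]vsubmxK -ReM_cplx_usubmx -ReM_cplx_dsubmx.
  rewrite -cplx_V_mx -cplx_W_mx mul_row_col mulNmx mul1mx -FV.
  by rewrite /cplx_mx map_mxM subrr.
apply: (can_inj (mulmxK uV)); rewrite mulmxKV //.
apply: (map_mx_inj (f := real_complex R)); rewrite map_mxM.
rewrite -/(cplx_mx W) -/(cplx_mx F) -/(cplx_mx V) cplx_V_mx cplx_W_mx.
by rewrite -E mul_ReM_cplx.
Qed.

Lemma gain_solves_EPP : solves_EPP A B lam erefl (W *m invmx V).
Proof.
apply: (solves_EPP_unnormalized uX); rewrite -M_mx_closed_loop.
rewrite /cplx_mx map_mxD map_mxM mulmxDl -mulmxA; congr (_ + _ *m _).
exact/gain_mxE.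
Qed.

End FixedParameter.

Hypothesis hlam_inj : injective lam.
Hypothesis hlam_pair : forall i j, conj_pair s i j -> lam j = (lam i)^*%C.
Hypothesis hlam_real : forall i : 'I_nu, (s.*2 <= i)%N -> lam i \is Num.real.

Lemma solves_EPP_param (F : 'M[R]_(m, n)) :
  solves_EPP A B lam erefl F ->
  exists K : forall i : 'I_nu, 'M[R[i]]_(d i, mu i),
    [/\ admissible s K, usubmx (M_mx T K) \in unitmx
      & cplx_mx F *m usubmx (M_mx T K) = dsubmx (M_mx T K)].
Proof.
move=> [X [uX _]]; rewrite castmx_id => /mul_Lambda_mxP EX.
have [Z [Zeig Zpair Zreal]] :=
  selfconj_eigenblocks hs hmu hlam_pair hlam_real
    (fun i => submxrow_free i uX) EX.
(* Stacking [z] with [F z] is multiplication by a real matrix, so it preserves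
   conjugation and realness. *)
pose C := col_mx 1%:M (cplx_mx F).
have rC : C \is a mxOver Num.real.
  apply/conj_mx_real; rewrite /C /conj_mx map_col_mx map_mx1; congr col_mx.
  by apply/matrixP => a b; rewrite !mxE; exact: conjc_real.
have CZ i : S_mx A B (lam i) *m (C *m Z i) = 0.
  rewrite S_mx_mul /C mul_col_mx mul1mx col_mxKu col_mxKd mulmxA -mulmxDl.
  by rewrite /cplx_mx -map_mxM -map_mxD; have [_ ->] := Zeig i; rewrite subrr.
pose K i := projT1 (cid (nullspace_basis_lift (hT i) (CZ i))).
have TK i : T i *m K i = C *m Z i by rewrite /K; case: (cid _) => /= k ->.
have XK : usubmx (M_mx T K) = \mxrow_i Z i.
  rewrite M_mxE usubmx_mxrow; apply: eq_mxrow => i.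
  by rewrite TK /C mul_col_mx col_mxKu mul1mx.
exists K; rewrite XK; split.
- split=> [i j ij|i ige].
    apply: conjugate_mx_sym; apply: conjugate_mx_cancel (hT_pair ij) _.
      by have [] := hT j.
    rewrite !TK; apply: conjugate_mxM; last exact: Zpair.
    by exists (erefl, erefl); rewrite castmx_id; have /conj_mx_real-> := rC.
  apply: real_mx_cancel (hT_real ige) _; first by have [] := hT i.
  rewrite TK; apply/conj_mx_real; rewrite /conj_mx map_mxM; congr (_ *m _).
    exact/conj_mx_real.
  exact/conj_mx_real/Zreal.
- apply: (mxrow_eigen_unit (G := cplx_mx (A + B *m F)) hlam_inj) => i;
    by have [] := Zeig i.
- rewrite mul_mxrow M_mxE dsubmx_mxrow; apply: eq_mxrow => i.
  by rewrite TK /C mul_col_mx col_mxKd.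
Qed.

Lemma coord_poly_det_X (K0 : forall i : 'I_nu, 'M[R[i]]_(d i, mu i)) :
  admissible s K0 -> coord_poly s (fun K => \det (usubmx (M_mx T K))).
Proof.
move=> aK0; apply: coord_poly_det => a b.
pose j := tagnat.sig1 b.
apply: (@eq_coord_poly _ _ _ _ _
  (fun K => \sum_k T j (lshift m a) k * K j k (tagnat.sig2 b))).
  by move=> K; rewrite M_mxE !mxE.
apply: coord_poly_sum => k; apply: coord_polyM; first exact: coord_poly_cst.
exact: (coord_poly_entry hs _ _ aK0).
Qed.

End Gains.

Theorem proposition2p1 (R : realType) (n m nu s : nat)
    (A : 'M[R]_n) (B : 'M[R]_(n, m))
    (hB : \rank B = m)
    (lam : 'I_nu -> R[i]) (mu : 'I_nu -> nat)
    (hlam_inj : injective lam)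
    (hlam_conj : forall i, exists j, lam j = (lam i)^*%C)
    (hmu_pos : forall i : 'I_nu, (0 < mu i)%N)
    (hn : (\sum_i mu i)%N = n)
    (hmu_conj : forall i j, lam j = (lam i)^*%C -> mu j = mu i)
    (hunc : forall z, uncontrollable_mode A B z -> exists i, lam i = z)
    (hsolv : exists F : 'M[R]_(m, n), solves_EPP A B lam hn F)
    (hs : (s.*2 <= nu)%N)
    (hlam_nonreal : forall i : 'I_nu, (i < s.*2)%N -> lam i \isn't Num.real)
    (hlam_real : forall i : 'I_nu, (s.*2 <= i)%N -> lam i \is Num.real)
    (hlam_pair : forall i j, conj_pair s i j -> lam j = (lam i)^*%C)
    (d : 'I_nu -> nat)
    (hd : forall i, d i = nullity (S_mx A B (lam i)))
    (T : forall i : 'I_nu, 'M[R[i]]_(n + m, d i))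
    (hT : forall i, nullspace_basis (S_mx A B (lam i)) (T i))
    (hT_pair : forall i j, conj_pair s i j -> conjugate_mx (T i) (T j))
    (hT_real : forall i : 'I_nu, (s.*2 <= i)%N -> T i \is a mxOver Num.real) :
  for_almost_every_K s
    (fun K : forall i : 'I_nu, 'M[R[i]]_(d i, mu i) =>
       \rank (X_mx hn T K) = n)
  /\
  (forall K : forall i : 'I_nu, 'M[R[i]]_(d i, mu i),
     admissible s K -> \rank (X_mx hn T K) = n ->
     V_mx s hn T K \in unitmx)
  /\
  [set F : 'M[R]_(m, n) | solves_EPP A B lam hn F] =
  [set W_mx s hn T K *m invmx (V_mx s hn T K) | K in
    [set K : forall i : 'I_nu, 'M[R[i]]_(d i, mu i) |
      admissible s K /\ \rank (X_mx hn T K) = n]].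
Proof.
have hmu i j : conj_pair s i j -> mu j = mu i.
  by move=> /hlam_pair; exact: hmu_conj.
subst n.
have rankX K : (\rank (X_mx erefl T K) = \sum_i mu i)%N <->
    usubmx (M_mx T K) \in unitmx.
  rewrite /X_mx castmx_id -row_free_unit /row_free.
  by split=> [->|/eqP].
have param :=
  solves_EPP_param hs hmu hT_pair hT_real hT hlam_inj hlam_pair hlam_real.
split; last split.
- have [F0 /param[K0 [aK0 uX0 _]]] := hsolv.
  rewrite unitmxE unitfE in uX0.
  have [N [mN N0 sN]] :=
    coord_poly_negligible (coord_poly_det_X T hs aK0) aK0 uX0.
  exists N; split=> // _ [K [aK rK] <-]; apply: sN; exists K => //.
  by split=> // detK; apply/rK/rankX; rewrite unitmxE unitfE.
- by move=> K aK /rankX; exact: V_mx_unit.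
- apply/seteqP; split=> F /=.
    move=> /param[K [aK uX FX]]; exists K; first by split=> //; exact/rankX.
    exact/gain_mxE.
  by move=> [K [aK /rankX uX] <-]; exact: gain_solves_EPP.
Qed.
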